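(* Let $\Sigma\subseteq\mathbb{R}^n$ be an $m$-Ahlfors regular ($\mathcal{H}^m$-measurable) set such that $\mathcal{E}_p(\Sigma)<\infty$ for some $p>m(m+2)$. Then there exist constants $C>0$ and $\tau\in(0,1)$ such that for any $x\in\Sigma$ and any $r>0$ small enough $$\beta(x,r)\le C\,r^{\tau}.$$
   Context: Integers $0<m<n$ are fixed. $\mathcal{H}^k$ is $k$-dimensional Hausdorff measure; $\mathbb{B}(x,r)$, $\overline{\mathbb{B}}(x,r)$ are the open and closed balls in $\mathbb{R}^n$; $G(n,m)$ is the Grassmannian of $m$-dimensional linear subspaces of $\mathbb{R}^n$. $m$-Ahlfors regular here means: there exist $A_\Sigma>0$, $R_\Sigma>0$ with $\mathcal{H}^m(\Sigma\cap\mathbb{B}(x,r))\ge A_\Sigma r^m$ for all $x\in\Sigma$ and $r\in(0,R_\Sigma)$. Energy: for points with $\operatorname{diam}\{x_0,\dots,x_{m+1}\}>0$, $\mathcal{K}(x_0,\dots,x_{m+1}):=\mathcal{H}^{m+1}(\operatorname{conv}\{x_0,\dots,x_{m+1}\})/\operatorname{diam}(\{x_0,\dots,x_{m+1}\})^{m+2}$, and $\mathcal{E}_p(\Sigma):=\int_{\Sigma^{m+2}}\mathcal{K}(x_0,\dots,x_{m+1})^p\,d\mathcal{H}^m_{x_0}\cdots d\mathcal{H}^m_{x_{m+1}}$. P. Jones' $\beta$-numbers of $\Sigma$: $\beta(x,r):=\frac1r\inf_{H\in G(n,m)}\ \sup_{z\in\Sigma\cap\overline{\mathbb{B}}(x,r)}\operatorname{dist}(z,x+H)$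 for $x\in\Sigma$, $r>0$. *)

(* Defs.v *)
(* Points of R^n are row vectors 'rV[R]_n with R : realType.
   The norm `|x| that the library puts on 'rV[R]_n is the sup norm, so the
   Euclidean metric notions are defined here. *)
From HB Require Import structures.
From mathcomp Require Import all_boot all_order all_algebra.
From mathcomp Require Import all_classical all_reals all_analysis.

Set Implicit Arguments.
Unset Strict Implicit.
Unset Printing Implicit Defensive.

Import Order.TTheory GRing.Theory Num.Theory.
Import numFieldNormedType.Exports.

Local Open Scope classical_set_scope.
Local Open Scope ring_scope.

Section euclidean.
Context {R : realType} {n : nat}.
Implicit Types (x y z : 'rV[R]_n) (A : set 'rV[R]_n).

Definition enorm x : R := Num.sqrt (\sum_(i < n) x ord0 i ^+ 2).

Definition eball x (r : R) : set 'rV[R]_n := [set y | enorm (y - x) < r].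

Definition ecball x (r : R) : set 'rV[R]_n := [set y | enorm (y - x) <= r].

Definition dist_set z A : R := inf [set enorm (z - y) | y in A].

(* The maximum with 0 only matters for the empty set, whose diameter is 0. *)
Definition diam A : \bar R :=
  maxe 0%E (ereal_sup [set (enorm (z.1 - z.2))%:E | z in A `*` A]).

Definition conv A : set 'rV[R]_n := smallest (@convex_set R 'rV[R]_n) A.

Definition translate x (H : {vspace 'rV[R]_n}) : set 'rV[R]_n :=
  [set x + h | h in [set` H]].

Definition grassmannian (m : nat) : set {vspace 'rV[R]_n} :=
  [set H | (\dim H = m)%N].

End euclidean.

(* Lebesgue measure of the unit ball of R^k, through the recurrence
   omega_(k+2) = 2 pi / (k + 2) * omega_k. *)
Fixpoint unit_ball_volume (R : realType) (k : nat) : R :=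
  match k with
  | 0%N => 1
  | 1%N => 2
  | k'.+2 => 2 * pi / k'.+2%:R * unit_ball_volume R k'
  end.

Section hausdorff.
Context {R : realType} {n : nat}.
Local Open Scope ereal_scope.

(* The case distinction only matters for k = 0, because diam^0 = 1. *)
Definition hausdorff_gauge (k : nat) (S : set 'rV[R]_n) : \bar R :=
  if `[< S = set0 >] then 0
  else (unit_ball_volume R k / 2 ^+ k)%:E * diam S ^+ k.

Definition hausdorff_content (k : nat) (delta : R) (A : set 'rV[R]_n) : \bar R :=
  ereal_inf [set \sum_(i <oo) hausdorff_gauge k (F i) |
    F in [set F : (set 'rV[R]_n)^nat |
      (forall i, diam (F i) <= delta%:E) /\ A `<=` \bigcup_i F i]].

Definition hausdorff (k : nat) (A : set 'rV[R]_n) : \bar R :=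
  ereal_sup [set hausdorff_content k delta A | delta in [set d : R | (0 < d)%R]].

Lemma diam_ge0 (S : set 'rV[R]_n) : 0 <= diam S.
Proof. by rewrite /diam le_max lexx. Qed.

Lemma diam0 : diam (set0 : set 'rV[R]_n) = 0.
Proof. by rewrite /diam set0X image_set0 ereal_sup0 maxeNy. Qed.

Lemma unit_ball_volume_ge0 k : (0 <= unit_ball_volume R k)%R.
Proof.
elim/ltn_ind: k => -[|[|k]] IH //=.
by rewrite mulr_ge0 ?IH// divr_ge0// mulr_ge0// pi_ge0.
Qed.

Lemma hausdorff_gauge0 k : hausdorff_gauge k set0 = 0.
Proof. by rewrite /hausdorff_gauge; case: asboolP. Qed.

Lemma hausdorff_gauge_ge0 k S : 0 <= hausdorff_gauge k S.
Proof.
rewrite /hausdorff_gauge; case: ifP => // _.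
rewrite mule_ge0 ?expe_ge0 ?diam_ge0// lee_fin divr_ge0 ?exprn_ge0//.
exact: unit_ball_volume_ge0.
Qed.

Lemma hausdorff_content_ge0 k delta A : 0 <= hausdorff_content k delta A.
Proof.
apply: le_ereal_inf_tmp => _ [F _ <-].
by apply: nneseries_ge0 => i _ _; exact: hausdorff_gauge_ge0.
Qed.

Lemma le_hausdorff_content k delta :
  {homo hausdorff_content k delta : A B / A `<=` B >-> A <= B}.
Proof.
move=> A B AB; apply/ereal_inf_le_tmp => _ [F [Fd BF] <-].
by exists F => //; split => //; exact: subset_trans BF.
Qed.

Lemma hausdorff_content0 k (delta : R) : (0 < delta)%R ->
  hausdorff_content k delta set0 = 0.
Proof.
move=> d0; apply/eqP; rewrite eq_le hausdorff_content_ge0 andbT.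
apply: ereal_inf_lbound; exists (fun=> set0).
  by split => // i; rewrite diam0 lee_fin ltW.
by apply: eseries0 => i _ _; exact: hausdorff_gauge0.
Qed.

Let disc := g_sigma_algebraType [set: set 'rV[R]_n].

Let measurable_disc (A : set disc) : measurable A.
Proof. exact: sub_sigma_algebra. Qed.

Let bounded_gauge k (delta : R) (S : set disc) : \bar R :=
  if diam S <= delta%:E then hausdorff_gauge k S else +oo.

Let hausdorff_contentE k (delta : R) : (0 < delta)%R ->
  hausdorff_content k delta = mu_ext (bounded_gauge k delta).
Proof.
move=> d0; apply/funext => A; apply/eqP; rewrite eq_le; apply/andP; split.
  apply: le_ereal_inf_tmp => _ [F [_ AF] <-].
  have bg0 i : 0 <= bounded_gauge k delta (F i).
    by rewrite /bounded_gauge; case: ifP; rewrite ?hausdorff_gauge_ge0 ?leey.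
  have [Fd|/existsNP[i Fid]] := pselect (forall i, diam (F i) <= delta%:E).
    apply: ereal_inf_lbound; exists F => //.
    by apply: eq_eseriesr => i _; rewrite /bounded_gauge Fd.
  rewrite (@eseries_pinfty _ _ predT i) ?leey//.
    by move=> j _; rewrite gt_eqF// (lt_le_trans _ (bg0 j)).
  by rewrite /bounded_gauge; move/negP: Fid => /negbTE ->.
apply: le_ereal_inf_tmp => _ [F [Fd AF] <-].
apply: ereal_inf_lbound; exists F; first by split => // i; exact: measurable_disc.
by apply: eq_eseriesr => i _; rewrite /bounded_gauge Fd.
Qed.

Lemma hausdorff_content_sigma_subadditive k (delta : R) : (0 < delta)%R ->
  sigma_subadditive (hausdorff_content k delta).
Proof.
move=> d0; rewrite hausdorff_contentE//.
have bg_ge0 (S : set disc) : 0 <= bounded_gauge k delta S.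
  by rewrite /bounded_gauge; case: ifP; rewrite ?hausdorff_gauge_ge0 ?leey.
exact: (@mu_ext_sigma_subadditive _ disc R _ bg_ge0).
Qed.

Lemma hausdorff_ge0 k A : 0 <= hausdorff k A.
Proof.
apply: le_trans (hausdorff_content_ge0 k 1 A) _.
by apply: ereal_sup_ubound; exists 1%R => //=.
Qed.

Lemma hausdorff0 k : hausdorff k set0 = 0.
Proof.
apply/eqP; rewrite eq_le hausdorff_ge0 andbT.
by apply: ge_ereal_sup => _ [d d0 <-]; rewrite hausdorff_content0.
Qed.

Lemma le_hausdorff k : {homo hausdorff k : A B / A `<=` B >-> A <= B}.
Proof.
move=> A B AB; apply: ge_ereal_sup => _ [d d0 <-].
apply: le_trans (le_hausdorff_content k d AB) _.
by apply: ereal_sup_ubound; exists d.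
Qed.

Lemma hausdorff_sigma_subadditive k : sigma_subadditive (hausdorff k).
Proof.
move=> F; apply: ge_ereal_sup => _ [d d0 <-].
apply: le_trans (hausdorff_content_sigma_subadditive k d0 F) _.
apply: lee_nneseries => i _ *; first exact: hausdorff_content_ge0.
by apply: ereal_sup_ubound; exists d.
Qed.

HB.instance Definition _ k := isOuterMeasure.Build R 'rV[R]_n (hausdorff k)
  (hausdorff0 k) (hausdorff_ge0 k) (@le_hausdorff k)
  (@hausdorff_sigma_subadditive k).

(* The outer measure restricted to its Caratheodory sigma-algebra. *)
Definition hausdorff_measure (k : nat) :
  set (caratheodory_type (hausdorff k)) -> \bar R := hausdorff k.

Arguments hausdorff_measure k _ : clear implicits.

HB.instance Definition _ k := isMeasure.Build _ _ _ (hausdorff_measure k)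
  (@caratheodory_measure0 _ _ (hausdorff k))
  (@caratheodory_measure_ge0 _ _ (hausdorff k))
  (@caratheodory_measure_sigma_additive _ _ (hausdorff k)).

End hausdorff.

Arguments hausdorff_measure {R n} k _.

(* The integral of f(x_0, ..., x_(k-1)) over D^k as an iterated integral.
   A product measure is not available: the library's product requires
   sigma-finite factors, and H^m is not sigma-finite on R^n when m < n. *)
Fixpoint iterated_integral d (T : measurableType d) (R : realType)
    (mu : {measure set T -> \bar R}) (D : set T) (k : nat) :
    (k.-tuple T -> \bar R) -> \bar R :=
  match k with
  | 0%N => fun f => f [tuple]
  | k'.+1 => fun f => (\int[mu]_(x in D)
      iterated_integral mu D (fun t : k'.-tuple T => f [tuple of x :: t]))%E
  end.

Section energy.
Context {R : realType} {n : nat}.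

(* On the tuples with diameter 0, where the quotient is meaningless, the value
   is 0 * +oo = 0. *)
Definition discrete_curvature (m : nat) (x : m.+2.-tuple 'rV[R]_n) : \bar R :=
  (hausdorff m.+1 (conv [set` x]) / diam [set` x] ^+ m.+2)%E.

Definition energy (m : nat) (p : R) (Sigma : set 'rV[R]_n) : \bar R :=
  iterated_integral (hausdorff_measure m) Sigma
    (fun x : m.+2.-tuple 'rV[R]_n => (discrete_curvature x `^ p)%E).

(* One-sided: only the lower mass bound is required. *)
Definition ahlfors_regular (m : nat) (Sigma : set 'rV[R]_n) : Prop :=
  exists A R0 : R, [/\ 0 < A, 0 < R0 & forall x r, Sigma x -> 0 < r < R0 ->
    ((A * r ^+ m)%:E <= hausdorff m (Sigma `&` eball x r))%E].

(* For x in Sigma, r > 0 and m <= n the set under sup is nonempty and bounded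
   by r, and the set under inf is nonempty and bounded below by 0. *)
Definition beta (m : nat) (Sigma : set 'rV[R]_n) (x : 'rV[R]_n) (r : R) : R :=
  r^-1 * inf [set sup [set dist_set z (translate x H) | z in Sigma `&` ecball x r]
             | H in grassmannian m].

End energy.

(* Main.v *)
Require Import Defs.
From mathcomp Require Import all_boot all_order all_algebra.
From mathcomp Require Import all_classical all_reals all_analysis.
From mathcomp Require Import measurable_realfun ring lra.
Import Order.TTheory GRing.Theory Num.Theory.
Import numFieldNormedType.Exports.
Local Open Scope classical_set_scope.
Local Open Scope ring_scope.

Set Implicit Arguments.
Unset Strict Implicit.
Unset Printing Implicit Defensive.

(** Suppose that b is a little smaller than r * beta(x, r).  Then no m-plane
    through x comes within b of all points of Sigma in the ball of radius r
    about x.  So m + 1 points x + v_i of Sigma can be chosen greedily in this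
    ball, each at distance at least b from the plane through x and the previous
    ones (beta_gap, exists_dual_system).  The v_i come with dual vectors l_j,
    <v_i, l_j> = delta_ij, of norm at most N / r, where N is bounded by a power
    of 1 / beta (dual_bound_poly).

    This frame is stable: if the m + 2 vertices are moved by at most
    s = r / (8 (m + 1) N), the matrix of the products <v_i, l_j> stays close to
    the identity.  The map y |-> (<y - y_0, l_j>)_j then sends the moved simplex
    onto a set that contains a cube of fixed side (near_identity_solve), and as
    it is Lipschitz with constant N / r, the simplex has (m+1)-dimensional
    Hausdorff measure at least a constant times (r / N)^(m+1)
    (hausdorff_simplex_ge).  That a cube in R^k cannot be covered by sets with a
    small sum of diam^k is cube_cover_volume.  Since the diameter is at most 4r,
    the curvature of all these simplices is at least a constant times
    N^-(m+1) / r.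

    In each of the m + 2 balls of radius s, Sigma has measure at least A s^m, and
    balls are measurable by Caratheodory's criterion
    (caratheodory_measurable_eball), so iterated integration gives
      energy >= c * (N^-(m+1) / r)^p * (r / N)^(m (m+2))
    (energy_ge).  With a finite left-hand side this bounds a power of 1/N, hence
    a power of beta, by r^(p - m (m+2)), whose exponent is positive
    (solve_exponents).

    The exponent obtained for beta is not optimal: choosing vertices greedily
    instead of maximizing the volume of the simplex loses powers of beta, but
    the loss is scale invariant and so affects only tau and not its sign. *)

(** * Lower bounds for integrals *)

(** The integral of a nonnegative function is a supremum over the simple
    functions below it, so this bound also holds for integrands of unknown
    measurability, such as iterated integrals of the curvature. *)
Lemma integral_ge_on d (T : measurableType d) (R : realType)
    (mu : {measure set T -> \bar R}) (D B : set T) (f : T -> \bar R) (c : R) :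
  measurable B -> B `<=` D -> 0 <= c ->
  (forall x, D x -> (0 <= f x)%E) -> (forall x, B x -> (c%:E <= f x)%E) ->
  (c%:E * mu B <= \int[mu]_(x in D) f x)%E.
Proof.
move=> mB BD c0 f0 fc; rewrite ge0_integralE//.
apply: ereal_sup_ubound => /=; exists (scale_nnsfun (indic_nnsfun R mB) c0).
  move=> x /=; rewrite patchE /mindic indicE; case: ifPn => [/set_mem Dx|xD].
    have [/set_mem/fc|_] := boolP (x \in B); first by rewrite mulr1.
    by rewrite mulr0 f0.
  by rewrite memNset ?mulr0// => /BD/mem_set; exact/negP.
by rewrite /= sintegralrM sintegral_indic.
Qed.

Lemma iterated_integral_ge0 d (T : measurableType d) (R : realType)
    (mu : {measure set T -> \bar R}) (D : set T) k (f : k.-tuple T -> \bar R) :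
  (forall t, (0 <= f t)%E) -> (0 <= iterated_integral mu D f)%E.
Proof.
elim: k f => [|k IH] f f0 /=; first exact: f0.
by apply: integral_ge0 => x _; apply: IH.
Qed.

Lemma iterated_integral_ge d (T : measurableType d) (R : realType)
    (mu : {measure set T -> \bar R}) (D : set T) k (f : k.-tuple T -> \bar R)
    (B : nat -> set T) (a c : R) : 0 <= a -> 0 <= c ->
  (forall t, (0 <= f t)%E) ->
  (forall i, (i < k)%N -> [/\ measurable (B i), B i `<=` D & (a%:E <= mu (B i))%E]) ->
  (forall t : k.-tuple T, (forall i : 'I_k, B i (tnth t i)) -> (c%:E <= f t)%E) ->
  ((c * a ^+ k)%:E <= iterated_integral mu D f)%E.
Proof.
move=> a0; elim: k B c f => [|k IH] B c f c0 f0 HB fc /=.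
  by rewrite expr0 mulr1 fc// => -[].
have [mB BD aB] := HB 0%N isT.
apply: (@le_trans _ _ ((c * a ^+ k)%:E * mu (B 0%N))%E).
  by rewrite exprSr mulrA EFinM lee_wpmul2l// lee_fin mulr_ge0// exprn_ge0.
apply: integral_ge_on => //; first by rewrite mulr_ge0// exprn_ge0.
  by move=> x _; apply: iterated_integral_ge0.
move=> x Bx; apply: (IH (fun i => B i.+1)) => // [i ik|t Bt]; first exact: HB.
apply: fc => i; case: (unliftP ord0 i) => [j|] ->; last by rewrite tnth0.
rewrite tnthS; exact: Bt.
Qed.

(** * Euclidean geometry of row vectors *)

Definition dotp {R : realType} {n : nat} (u v : 'rV[R]_n) : R :=
  \sum_(i < n) u ord0 i * v ord0 i.

Section euclidean_space.
Context {R : realType} {n : nat}.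
Implicit Types (u v w : 'rV[R]_n) (a : R).

Lemma dotpC u v : dotp u v = dotp v u.
Proof. by apply: eq_bigr => i _; rewrite mulrC. Qed.

Lemma dotpDl u v w : dotp (u + v) w = dotp u w + dotp v w.
Proof. by rewrite /dotp -big_split; apply: eq_bigr => i _; rewrite mxE mulrDl. Qed.

Lemma dotpZl a u v : dotp (a *: u) v = a * dotp u v.
Proof. by rewrite /dotp mulr_sumr; apply: eq_bigr => i _; rewrite mxE mulrA. Qed.

Lemma dotpNl u v : dotp (- u) v = - dotp u v.
Proof. by rewrite -scaleN1r dotpZl mulN1r. Qed.

Lemma dotpBl u v w : dotp (u - v) w = dotp u w - dotp v w.
Proof. by rewrite dotpDl dotpNl. Qed.

Lemma dotpBr u v w : dotp w (u - v) = dotp w u - dotp w v.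
Proof. by rewrite dotpC dotpBl !(dotpC w). Qed.

Lemma dotpZr a u v : dotp v (a *: u) = a * dotp v u.
Proof. by rewrite dotpC dotpZl dotpC. Qed.

Lemma dotp0l v : dotp 0 v = 0.
Proof. by rewrite -(scale0r v) dotpZl mul0r. Qed.

Lemma dotp_suml (I : Type) (s : seq I) (P : pred I) (F : I -> 'rV[R]_n) v :
  dotp (\sum_(i <- s | P i) F i) v = \sum_(i <- s | P i) dotp (F i) v.
Proof.
by apply: (big_morph (fun u => dotp u v) (fun u w => dotpDl u w v) (dotp0l v)).
Qed.

Lemma dotp_sumr (I : Type) (s : seq I) (P : pred I) (F : I -> 'rV[R]_n) v :
  dotp v (\sum_(i <- s | P i) F i) = \sum_(i <- s | P i) dotp v (F i).
Proof. by rewrite dotpC dotp_suml; apply: eq_bigr => i _; rewrite dotpC. Qed.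

Lemma dotp_self_ge0 u : 0 <= dotp u u.
Proof. by apply: sumr_ge0 => i _; rewrite -expr2 sqr_ge0. Qed.

Lemma enormE u : enorm u = Num.sqrt (dotp u u).
Proof. by congr Num.sqrt; apply: eq_bigr => i _; rewrite expr2. Qed.

Lemma enorm_ge0 u : 0 <= enorm u.
Proof. exact: sqrtr_ge0. Qed.

Lemma sqr_enorm u : enorm u ^+ 2 = dotp u u.
Proof. by rewrite enormE sqr_sqrtr// dotp_self_ge0. Qed.

Lemma enormZ a u : enorm (a *: u) = `|a| * enorm u.
Proof.
rewrite !enormE dotpZl dotpZr mulrA -expr2 sqrtrM ?sqr_ge0//.
by rewrite sqrtr_sqr.
Qed.

Lemma enormN u : enorm (- u) = enorm u.
Proof. by rewrite -scaleN1r enormZ normrN1 mul1r. Qed.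

Lemma enormB u v : enorm (u - v) = enorm (v - u).
Proof. by rewrite -enormN opprB. Qed.

Lemma enorm0 : enorm (0 : 'rV[R]_n) = 0.
Proof. by rewrite enormE dotp0l sqrtr0. Qed.

Lemma enorm0_eq0 u : enorm u = 0 -> u = 0.
Proof.
move=> u0; apply/rowP => i; rewrite mxE; apply/eqP.
have := sqr_enorm u; rewrite u0 expr0n /= => /esym/eqP.
rewrite psumr_eq0; last by move=> j _; rewrite -expr2 sqr_ge0.
by move=> /allP/(_ i); rewrite mem_index_enum => /(_ isT)/=; rewrite -expr2 sqrf_eq0.
Qed.

Lemma dotp_le_enorm u v : dotp u v <= enorm u * enorm v.
Proof.
have [u0|u0] := eqVneq (enorm u) 0.
  by rewrite (enorm0_eq0 u0) dotp0l enorm0 mul0r.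
have [v0|v0] := eqVneq (enorm v) 0.
  by rewrite (enorm0_eq0 v0) dotpC dotp0l enorm0 mulr0.
have up : 0 < enorm u by rewrite lt_def u0 enorm_ge0.
have vp : 0 < enorm v by rewrite lt_def v0 enorm_ge0.
have := dotp_self_ge0 (enorm v *: u - enorm u *: v).
rewrite !(dotpBl, dotpBr, dotpZl, dotpZr) (dotpC v u) -!sqr_enorm.
set a := enorm u; set b := enorm v; set c := dotp u v.
rewrite [leRHS](_ : _ = (2 * a * b) * (a * b - c)); last by ring.
by rewrite pmulr_rge0 ?subr_ge0// !mulr_gt0.
Qed.

Lemma norm_dotp_le u v : `|dotp u v| <= enorm u * enorm v.
Proof.
by rewrite ler_norml dotp_le_enorm lerNl -dotpNl -(enormN u) dotp_le_enorm.
Qed.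

Lemma enormD u v : enorm (u + v) <= enorm u + enorm v.
Proof.
rewrite -ler_sqr ?nnegrE ?addr_ge0 ?enorm_ge0//.
rewrite sqr_enorm dotpDl !(dotpC _ (u + v)) !dotpDl (dotpC v u).
rewrite sqrrD !sqr_enorm.
have := dotp_le_enorm u v; rewrite mulr2n; lra.
Qed.

Lemma enorm_triangle v u w : enorm (u - w) <= enorm (u - v) + enorm (v - w).
Proof. by rewrite (le_trans _ (enormD _ _))// subrKA. Qed.

Lemma enorm_sum_le (j : nat) (F : 'I_j -> 'rV[R]_n) :
  enorm (\sum_(i < j) F i) <= \sum_(i < j) enorm (F i).
Proof.
apply: (big_ind2 (fun x y => enorm x <= y)) => //.
  by rewrite enorm0.
move=> x1 x2 y1 y2 h1 h2; exact: le_trans (enormD _ _) (lerD h1 h2).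
Qed.

End euclidean_space.

(** * Greedy choice of a nondegenerate frame *)

(** Size of the dual vectors after j greedy steps, where rho is the ratio between
    the radius of the data and the distance gained at each step.  Its polynomial
    growth in rho is what becomes a power of beta in the end. *)
Fixpoint dual_bound {R : realType} (rho : R) (j : nat) : R :=
  if j is i.+1 then
    dual_bound rho i * (1 + (1 + i%:R * dual_bound rho i) * rho)
  else 1.

Lemma dual_bound_ge1 {R : realType} (rho : R) j : 0 <= rho -> 1 <= dual_bound rho j.
Proof.
move=> rho0; elim: j => //= j IH.
have j0 : 0 <= j%:R :> R by [].
rewrite -[leLHS]mul1r ler_pM// lerDl mulr_ge0// addr_ge0// mulr_ge0//.
exact: le_trans IH.
Qed.

Lemma dual_bound_poly {R : realType} j : exists (D : R) (q : nat),
  [/\ 1 <= D, (0 < q)%N & forall rho, 1 <= rho -> dual_bound rho j <= D * rho ^+ q].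
Proof.
elim: j => [|j [D [q [D1 q0 IH]]]].
  by exists 1, 1%N; split => // rho rho1; rewrite mul1r expr1.
have j0 : 0 <= j%:R :> R by [].
have D0 : 0 <= D by exact: le_trans D1.
exists (D * (2 + j%:R * D)), (q + q.+1)%N; split.
- by rewrite -[leLHS]mul1r ler_pM// -[leLHS]addr0 lerD ?mulr_ge0// ler1n.
- by rewrite addn_gt0 q0.
move=> rho rho1 /=.
have rho0 : 0 <= rho by exact: le_trans rho1.
have N0 : 0 <= dual_bound rho j by rewrite (le_trans _ (dual_bound_ge1 j rho0)).
have rq : 1 <= rho ^+ q by rewrite exprn_ege1.
have rq0 : 0 <= rho ^+ q by rewrite exprn_ge0.
rewrite exprD -mulrACA ler_pM ?IH//.
  by rewrite addr_ge0// mulr_ge0// addr_ge0// mulr_ge0.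
have h1 : 1 + j%:R * dual_bound rho j <= (1 + j%:R * D) * rho ^+ q.
  by rewrite mulrDl mul1r lerD// -mulrA ler_wpM2l// IH.
have h2 : 1 <= rho ^+ q.+1 by rewrite exprn_ege1.
rewrite (_ : 2 + _ = 1 + (1 + j%:R * D)); last by rewrite addrA.
rewrite [leRHS]mulrDl mul1r lerD// exprSr mulrA ler_wpM2r//.
Qed.

Section greedy.
Context {R : realType} {n : nat}.
Implicit Types (v l : nat -> 'rV[R]_n) (W : set 'rV[R]_n).

Definition dual_system (j : nat) v l :=
  forall i k, (i < j)%N -> (k < j)%N -> dotp (v i) (l k) = (i == k)%:R.

Lemma sumr_delta (F : nat -> R) j k : (k < j)%N ->
  \sum_(i < j) F i * (i == k :> nat)%:R = F k.
Proof.
move=> kj; rewrite (bigD1 (Ordinal kj))//= eqxx mulr1 big1 ?addr0// => i.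
by rewrite -val_eqE/= => /negbTE ->; rewrite mulr0.
Qed.

(** Subtracting from w its coordinates along v gives u, and u corrected by the
    old dual vectors so as to kill v, divided by |u|^2, is the dual vector of w.
    All norms are thus controlled by the previous bound M and by the lower bound
    b on |u|. *)
Lemma dual_system_step j v l (M r b : R) w : 0 < b -> 0 <= r -> 0 <= M ->
  dual_system j v l ->
  (forall i, (i < j)%N -> enorm (v i) <= r) ->
  (forall i, (i < j)%N -> enorm (l i) <= M) ->
  enorm w <= r ->
  b <= enorm (w - \sum_(i < j) dotp w (l i) *: v i) ->
  exists l', dual_system j.+1 (fun i => if i == j then w else v i) l' /\
    forall i, (i < j.+1)%N ->
      enorm (l' i) <= Num.max ((1 + j%:R * M * r) / b)
                        (M * (1 + r * ((1 + j%:R * M * r) / b))).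
Proof.
move=> b0 r0 M0 dvl vr lM wr; move uE : (w - _) => u bu.
have u0 : 0 < enorm u by exact: lt_le_trans bu.
have uu0 : dotp u u != 0 by rewrite -sqr_enorm sqrf_eq0 gt_eqF.
pose g := (dotp u u)^-1 *: (u - \sum_(i < j) dotp (v i) u *: l i).
have ul k : (k < j)%N -> dotp u (l k) = 0.
  move=> kj; rewrite -uE dotpBl dotp_suml.
  rewrite -[X in X - _](sumr_delta (fun i => dotp w (l i)) kj).
  by apply/eqP; rewrite subr_eq0; apply/eqP/eq_bigr => i _; rewrite dotpZl dvl.
have vg k : (k < j)%N -> dotp (v k) g = 0.
  move=> kj; rewrite dotpZr [dotp (v k) _]dotpBr dotp_sumr.
  rewrite -[X in X - _](sumr_delta (fun i => dotp (v i) u) kj).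
  rewrite -sumrB big1 ?mulr0// => i _.
  by rewrite dotpZr dvl// (eq_sym k) subrr.
have wg : dotp w g = 1.
  rewrite -[X in dotp X](subrK (\sum_(i < j) dotp w (l i) *: v i) w) uE.
  rewrite dotpDl dotp_suml big1 ?addr0; last by move=> i _; rewrite dotpZl vg// mulr0.
  rewrite /g dotpZr [dotp u (_ - _)]dotpBr dotp_sumr big1 ?subr0 ?mulVf// => i _.
  by rewrite dotpZr ul// mulr0.
have jMr0 : 0 <= j%:R * M * r by rewrite !mulr_ge0.
have gP : enorm g <= (1 + j%:R * M * r) / b.
  rewrite enormZ ger0_norm ?invr_ge0 ?dotp_self_ge0// -sqr_enorm expr2 invfM.
  have h : enorm (u - \sum_(i < j) dotp (v i) u *: l i) <=
      (1 + j%:R * M * r) * enorm u.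
    rewrite mulrDl mul1r (le_trans (enormD _ _))// lerD2l enormN.
    rewrite (le_trans (enorm_sum_le _))//.
    rewrite (le_trans (y := \sum_(i < j) M * r * enorm u))//.
      apply: ler_sum => i _; rewrite enormZ mulrC -mulrA ler_pM ?enorm_ge0 ?lM//.
      by rewrite (le_trans (norm_dotp_le _ _))// ler_wpM2r ?enorm_ge0// vr.
    by rewrite sumr_const card_ord -!mulrA mulr_natl.
  rewrite [leLHS]mulrAC ler_pM ?mulr_ge0 ?invr_ge0 ?enorm_ge0//.
    by rewrite ler_pdivrMl// mulrC.
  by rewrite lef_pV2.
pose l' i := if i == j then g else l i - dotp w (l i) *: g.
exists l'; split.
  move=> i k; rewrite !ltnS /l' => ij kj.
  have [iE|iNj] := eqVneq i j; have [kE|kNj] := eqVneq k j.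
  - by rewrite wg iE kE eqxx.
  - rewrite iE dotpBr dotpZr wg mulr1 subrr.
    by rewrite (eq_sym j) (negbTE kNj).
  - by rewrite vg ?kE ?(negbTE iNj)// ltn_neqAle iNj.
  - by rewrite dotpBr dotpZr vg ?mulr0 ?subr0 ?dvl// ltn_neqAle ?iNj ?kNj.
move=> i; rewrite ltnS /l' => ij; have [_|iNj] := eqVneq i j.
  by rewrite le_max gP.
have {ij iNj}ij : (i < j)%N by rewrite ltn_neqAle iNj.
rewrite le_max; apply/orP; right.
rewrite (le_trans (enormD _ _))// enormN mulrDr mulr1 lerD ?lM// enormZ mulrA.
rewrite ler_pM ?enorm_ge0//.
by rewrite (le_trans (norm_dotp_le _ _))// mulrC ler_pM ?enorm_ge0// lM.
Qed.

(** Greedy choice: at each of the m + 1 steps the vectors already chosen span a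
    subspace of dimension at most m, so W contains a vector at distance at least
    b from it. *)
Lemma exists_dual_system W (r b : R) (m : nat) : 0 < b -> b <= r ->
  (forall w, W w -> enorm w <= r) ->
  (forall U : {vspace 'rV[R]_n}, (\dim U <= m)%N ->
     exists2 w, W w & forall h, h \in U -> b <= enorm (w - h)) ->
  forall j, (j <= m.+1)%N -> exists v l, [/\ forall i, (i < j)%N -> W (v i),
    dual_system j v l &
    forall i, (i < j)%N -> enorm (l i) <= dual_bound (r / b) j / r].
Proof.
move=> b0 br Wr Wb; have r0 : 0 < r by exact: lt_le_trans br.
elim=> [_|j IH jm]; first by exists (fun=> 0), (fun=> 0).
have [v [l [vW dvl lN]]] := IH (ltnW jm).
have /Wb[w Ww wb] : (\dim <<[tuple v i | i < j]>>%VS <= m)%N.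
  by rewrite (leq_trans (dim_span _))// size_tuple.
set N := dual_bound (r / b) j in lN.
have rb1 : 1 <= r / b by rewrite ler_pdivlMr// mul1r.
have N1 : 1 <= N by rewrite dual_bound_ge1// (le_trans _ rb1).
have N0 : 0 <= N by exact: le_trans N1.
have bw : b <= enorm (w - \sum_(i < j) dotp w (l i) *: v i).
  apply: wb; apply: memv_suml => i _; apply: memvZ; apply: memv_span.
  by apply/mapP; exists i => //; rewrite mem_enum.
have vr i : (i < j)%N -> enorm (v i) <= r by move=> /vW/Wr.
have M0 : 0 <= N / r by rewrite divr_ge0// ltW.
have [l' [dvl' lM']] := dual_system_step b0 (ltW r0) M0 dvl vr lN (Wr _ Ww) bw.
exists (fun i => if i == j then w else v i), l'; split => //.
  by move=> i; rewrite ltnS; case: eqVneq => // iNj ij; apply: vW; rewrite ltn_neqAle iNj.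
move=> i ij; rewrite (le_trans (lM' _ ij))//=.
rewrite -/N -(mulrA j%:R) divfK ?gt_eqF//.
have jN0 : 0 <= 1 + j%:R * N by rewrite addr_ge0// mulr_ge0.
have e1 : N / r * (1 + r * ((1 + j%:R * N) / b)) =
    N * (1 + (1 + j%:R * N) * (r / b)) / r.
  by field; rewrite !gt_eqF.
rewrite e1 ge_max lexx andbT.
rewrite -[leLHS](mulfK (x := r)) ?gt_eqF// ler_wpM2r ?invr_ge0 ?(ltW r0)//.
rewrite -mulrA (mulrC b^-1) (le_trans _ (ler_peMl _ N1)) ?lerDr//.
by rewrite addr_ge0// mulr_ge0// (le_trans _ rb1).
Qed.

End greedy.

(** * Hausdorff measure of a set that projects onto a cube *)

(** Volume comparison by integrating over one coordinate at a time with
    one-dimensional Lebesgue measure.  Once the last coordinate is fixed, its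
    indicator functions join the weights, which is why weights are allowed. *)
Lemma cube_cover_volume {R : realType} (u s : R) (k : nat) : 0 <= s ->
  forall (C : R) (w d : nat -> R) (a : nat -> nat -> R),
  (forall i, 0 <= w i) -> (forall i, 0 <= d i) ->
  (forall t : nat -> R, (forall j, (j < k)%N -> u <= t j <= u + s) ->
    (C%:E <= \sum_(i <oo)
      (w i * \prod_(j < k) \1_(`[a i j, a i j + d i]%classic) (t j))%:E)%E) ->
  ((C * s ^+ k)%:E <= \sum_(i <oo) (w i * d i ^+ k)%:E)%E.
Proof.
move=> s0; elim: k => [|k IH] C w d a w0 d0 cover.
  rewrite expr0 mulr1 (le_trans (cover (fun=> 0) _))//.
  by apply: lee_nneseries => i *; rewrite ?big_ord0 ?expr0// mulr1 lee_fin.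
pose I i := `[a i k, a i k + d i]%classic.
pose D := `[u, u + s]%classic.
have mD : measurable D by exact: measurable_itv.
have mI i : measurable (I i) by exact: measurable_itv.
have slice x : D x ->
    ((C * s ^+ k)%:E <= \sum_(i <oo) (w i * d i ^+ k * \1_(I i) x)%:E)%E.
  rewrite /D /= in_itv/= => ux.
  under eq_eseriesr do rewrite mulrAC.
  apply: (IH _ _ _ a) => // [i|t ut]; first by rewrite mulr_ge0// indicE.
  have /cover : forall j, (j < k.+1)%N ->
      u <= (if j == k then x else t j) <= u + s.
    by move=> j; rewrite ltnS; case: eqVneq => // jk jk1; rewrite ut// ltn_neqAle jk.
  under eq_eseriesr => i _.
    rewrite big_ord_recr/= eqxx mulrA.
    under eq_bigr => j _ do rewrite (ltn_eqF (ltn_ord j)).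
    rewrite mulrAC.
    over.
  by [].
have wd0 i : 0 <= w i * d i ^+ k by rewrite mulr_ge0// exprn_ge0.
have lD : lebesgue_measure D = s%:E.
  rewrite /D lebesgue_measure_itv/= lte_fin.
  case: ltP => [_|]; first by rewrite -EFinD addrAC subrr add0r.
  by rewrite gerDl => s0'; congr EFin; apply/eqP; rewrite eq_le s0 s0'.
have mf i : measurable_fun D (fun x : R => (w i * d i ^+ k * \1_(I i) x)%:E).
  by apply/measurable_EFinP; apply: measurable_funM.
have lhs : ((C * s ^+ k.+1)%:E <=
    \int[@lebesgue_measure R]_(x in D) \sum_(i <oo) (w i * d i ^+ k * \1_(I i) x)%:E)%E.
  have [C0|C0] := leP 0 C; last first.
    rewrite (@le_trans _ _ 0%E) ?lee_fin ?mulr_le0_ge0 ?exprn_ge0 ?(ltW C0)//.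
    apply: integral_ge0 => x _; apply: nneseries_ge0 => i _ _.
    by rewrite lee_fin mulr_ge0// indicE.
  rewrite exprSr mulrA EFinM -lD; apply: integral_ge_on => //.
    by rewrite mulr_ge0// exprn_ge0.
  move=> x _; apply: nneseries_ge0 => i _ _.
  by rewrite lee_fin mulr_ge0// indicE.
apply: (le_trans lhs); rewrite integral_nneseries//; last first.
  by move=> i x _; rewrite lee_fin mulr_ge0// indicE.
apply: lee_nneseries => i.
  move=> _ _; apply: integral_ge0 => x _.
  by rewrite lee_fin mulr_ge0// indicE.
move=> _; under eq_integral do rewrite EFinM.
rewrite ge0_integralZl//; last 2 first.
- by apply/measurable_EFinP; apply: measurable_indic; exact: mI.
- by rewrite lee_fin.
rewrite integral_indic//; last exact: mI.
rewrite exprSr mulrA [leRHS]EFinM lee_wpmul2l ?lee_fin//.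
rewrite (@le_trans _ _ (lebesgue_measure (I i)))//.
  by rewrite le_measure ?inE//; [apply: measurableI => //; exact: mI|exact: mI].
rewrite /I lebesgue_measure_itv/= lte_fin.
by case: ltP => _; rewrite -?EFinD ?lee_fin// addrAC subrr add0r.
Qed.

Lemma unit_ball_volume_gt0 {R : realType} k : 0 < unit_ball_volume R k.
Proof.
elim/ltn_ind: k => -[|[|k]] IH //=.
by rewrite mulr_gt0 ?IH// divr_gt0// mulr_gt0// pi_gt0.
Qed.

Lemma enorm_le_diam {R : realType} {n : nat} (A : set 'rV[R]_n) y z : A y -> A z ->
  ((enorm (y - z))%:E <= diam A)%E.
Proof.
move=> Ay Az; rewrite /diam le_max; apply/orP; right.
by apply: ereal_sup_ubound; exists (y, z).
Qed.

Lemma diam_le {R : realType} {n : nat} (A : set 'rV[R]_n) (d : R) : 0 <= d ->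
  (forall y z, A y -> A z -> enorm (y - z) <= d) -> (diam A <= d%:E)%E.
Proof.
move=> d0 Ad; rewrite /diam ge_max lee_fin d0/=.
by apply: ge_ereal_sup => _ [[y z] [/= Ay Az] <-]; rewrite lee_fin Ad.
Qed.

(** Mass distribution principle: the functionals y |-> dotp (y - y0) (l j) are
    M-Lipschitz, so they map each covering set of diameter d into a box of side
    2 * M * d. *)
Lemma hausdorff_ge_cube {R : realType} {n : nat} (k : nat) (T : set 'rV[R]_n)
    (y0 : 'rV[R]_n) (l : nat -> 'rV[R]_n) (M u s : R) : (0 < k)%N ->
  0 < M -> 0 <= s -> (forall j, (j < k)%N -> enorm (l j) <= M) ->
  (forall t : nat -> R, (forall j, (j < k)%N -> u <= t j <= u + s) ->
    exists2 y, T y & forall j, (j < k)%N -> dotp (y - y0) (l j) = t j) ->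
  ((unit_ball_volume R k / 2 ^+ k * (s / (2 * M)) ^+ k)%:E <= hausdorff k T)%E.
Proof.
move=> k0 M0 s0 lM cube.
rewrite (@le_trans _ _ (hausdorff_content k 1 T))//; last first.
  by apply: ereal_sup_ubound; exists 1 => //=.
apply: le_ereal_inf_tmp => _ [F [Fd TF] <-].
have dfin i : diam (F i) \is a fin_num.
  by rewrite ge0_fin_numE ?diam_ge0// (le_lt_trans (Fd i))// ltry.
pose d i := fine (diam (F i)).
have d0 i : 0 <= d i by rewrite fine_ge0// diam_ge0.
(* Empty covering sets get weight 0, since no point of them can centre a box. *)
pose w i : R := if `[< F i = set0 >] then 0 else 1.
have w0 i : 0 <= w i by rewrite /w; case: ifP.
pose z i := get (F i).
pose a i j := dotp (z i - y0) (l j) - M * d i.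
have : ((1 * s ^+ k)%:E <= \sum_(i <oo) (w i * (2 * M * d i) ^+ k)%:E)%E.
  apply: (@cube_cover_volume _ u s k s0 1 w (fun i => 2 * M * d i) a) => //.
    by move=> i; rewrite mulr_ge0// mulr_ge0// ltW.
  move=> t /cube[y /TF[i _ Fiy] yt].
  rewrite (@nneseriesD1 _ _ i)//; last first.
    move=> j _; rewrite lee_fin mulr_ge0// prodr_ge0// => b _; by rewrite indicE.
  rewrite -[leLHS]adde0 leeD//; last first.
    apply: nneseries_ge0 => j _ _.
    rewrite lee_fin mulr_ge0// prodr_ge0// => b _; by rewrite indicE.
  rewrite lee_fin /w; case: asboolP => [F0|_]; first by rewrite F0 in Fiy.
  rewrite mul1r big1// => j _; rewrite indicE mem_set//= in_itv/= /a.
  have : `|dotp (y - y0) (l j) - dotp (z i - y0) (l j)| <= M * d i.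
    rewrite -dotpBl opprB addrA subrK (le_trans (norm_dotp_le _ _))// mulrC.
    rewrite ler_pM ?enorm_ge0 ?lM// -lee_fin /d fineK//.
    by apply: enorm_le_diam => //; apply: (@getI _ _ y).
  rewrite yt// ler_norml; lra.
rewrite mul1r => cov.
set c := unit_ball_volume R k / 2 ^+ k / (2 * M) ^+ k.
have c0 : 0 <= c.
  by rewrite !mulr_ge0 ?invr_ge0 ?exprn_ge0 ?mulr_ge0 ?unit_ball_volume_ge0// ltW.
rewrite expr_div_n mulrA mulrAC -/c EFinM.
apply: (@le_trans _ _ (c%:E * \sum_(i <oo) (w i * (2 * M * d i) ^+ k)%:E)%E).
  by rewrite lee_wpmul2l.
rewrite -nneseriesZl; last first.
  by move=> i _; rewrite lee_fin mulr_ge0// exprn_ge0// mulr_ge0// mulr_ge0// ltW.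
apply: lee_nneseries => [i _ _|i _].
  by rewrite -EFinM lee_fin mulr_ge0// mulr_ge0// exprn_ge0// mulr_ge0// mulr_ge0// ltW.
rewrite /hausdorff_gauge /w; case: asboolP => _; first by rewrite mul0r -EFinM mulr0.
rewrite mul1r -(fineK (dfin i)) -/(d i) -EFin_expe -!EFinM lee_fin exprMn.
by rewrite mulrA divfK// expf_neq0// gt_eqF// mulr_gt0.
Qed.

(** * Simplices with an almost dual frame *)

Lemma convex_set_comb {R : realType} {n : nat} (A : set 'rV[R]_n) :
  @convex_set R 'rV[R]_n A -> forall x y (t : R), A x -> A y -> 0 <= t <= 1 ->
  A (t *: x + (1 - t) *: y).
Proof.
move=> cA x y t Ax Ay /andP[t0 t1].
by have /set_mem := cA x y (Itv01 t0 t1) (mem_set Ax) (mem_set Ay).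
Qed.

Lemma conv_sum {R : realType} {n : nat} (A : set 'rV[R]_n) (k : nat)
    (y : nat -> 'rV[R]_n) (a : nat -> R) :
  (forall i, (i <= k)%N -> A (y i)) -> (forall i, (i <= k)%N -> 0 <= a i) ->
  \sum_(i < k.+1) a i = 1 -> Defs.conv A (\sum_(i < k.+1) a i *: y i).
Proof.
move=> Ay a0 a1 C [cC AC].
have {AC}Ay i : (i <= k)%N -> C (y i) by move=> /Ay/AC.
elim: k a a0 a1 Ay => [|k IH] a a0 a1 Cy.
  by move: a1; rewrite !big_ord_recr !big_ord0/= !add0r => ->; rewrite scale1r; exact: Cy.
rewrite big_ord_recr/=; move: a1; rewrite big_ord_recr/=.
set s := \sum_(i < k.+1) a i => a1.
have aE : a k.+1 = 1 - s by rewrite -a1 addrAC subrr add0r.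
have s0 : 0 <= s by apply: sumr_ge0 => i _; rewrite a0// ltnW// ltnS.
have s1 : s <= 1 by rewrite -subr_ge0 -aE a0.
have [s00|sN0] := eqVneq s 0.
  rewrite big1 ?add0r ?aE ?s00 ?subr0 ?scale1r; first exact: Cy.
  move=> i _; suff -> : a i = 0 by rewrite scale0r.
  have := s00; rewrite /s => /eqP; rewrite psumr_eq0.
    by move=> /allP/(_ i); rewrite mem_index_enum => /(_ isT)/eqP.
  by move=> j _; rewrite a0// ltnW// ltnS.
have -> : \sum_(i < k.+1) a i *: y i = s *: (\sum_(i < k.+1) (a i / s) *: y i).
  by rewrite scaler_sumr; apply: eq_bigr => i _; rewrite scalerA mulrCA divff// mulr1.
rewrite aE; apply: convex_set_comb => //; last by rewrite s0.
  apply: (IH (fun i => a i / s)) => [i ik||i ik]; last exact/Cy/ltnW.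
  - by rewrite divr_ge0// a0// ltnW.
  - by rewrite -mulr_suml divff.
exact: Cy.
Qed.

(** Comparing a with a G in the l^1 norm shows that G is invertible and that the
    solution of a G = t stays within 1/(4k) of t, hence nonnegative. *)
Lemma near_identity_solve {R : realType} (k : nat) (G : 'M[R]_k) (t : 'rV[R]_k) :
  (0 < k)%N ->
  (forall i j, `|G i j - (i == j)%:R| <= (4 * k%:R)^-1) ->
  (forall j, (4 * k%:R)^-1 <= t ord0 j <= (2 * k%:R)^-1) ->
  exists a : 'rV[R]_k, [/\ a *m G = t, forall i, 0 <= a ord0 i &
    \sum_i a ord0 i <= 1].
Proof.
move=> k0 GI tI; have kp : 0 < k%:R :> R by rewrite ltr0n.
have kN0 : k%:R != 0 :> R by rewrite gt_eqF.
set e := (4 * k%:R)^-1 in GI tI.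
pose S (a : 'rV[R]_k) := \sum_j `|a ord0 j|.
have key (a : 'rV[R]_k) j : `|a ord0 j - (a *m G) ord0 j| <= e * S a.
  have -> : a ord0 j - (a *m G) ord0 j = \sum_i a ord0 i * ((i == j)%:R - G i j).
    under eq_bigr do rewrite mulrBr; rewrite sumrB mxE; congr (_ - _).
    rewrite (bigD1 j)//= eqxx mulr1 big1 ?addr0// => i /negbTE ->.
    by rewrite mulr0.
  rewrite (le_trans (ler_norm_sum _ _ _))// /S mulr_sumr; apply: ler_sum => i _.
  by rewrite normrM mulrC ler_wpM2r// distrC.
have key2 (a : 'rV[R]_k) : S a <= S (a *m G) + S a / 4.
  have -> : S a / 4 = \sum_(j < k) e * S a.
    by rewrite sumr_const card_ord -mulr_natl /e; field.
  rewrite /S -big_split; apply: ler_sum => j _; rewrite -/(S a).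
  rewrite -lerBlDl (le_trans _ (key a j))//.
  by rewrite (le_trans (lerB_dist _ _)).
have Gu : G \in unitmx.
  rewrite -row_free_unit; apply: inj_row_free => v vG.
  have S0 : S v <= 0.
    have := key2 v; rewrite vG.
    have -> : S 0 = 0 by rewrite /S big1// => j _; rewrite mxE normr0.
    lra.
  apply/rowP => j; rewrite mxE; apply/eqP; rewrite -normr_le0.
  by rewrite (le_trans _ S0)// /S (bigD1 j)//= lerDl sumr_ge0.
pose a := t *m invmx G.
have aG : a *m G = t by rewrite mulmxKV.
have St : S t <= 2^-1.
  rewrite (le_trans (y := \sum_(j < k) (2 * k%:R)^-1))//.
    apply: ler_sum => j _; have /andP[t1 t2] := tI j.
    by rewrite ger0_norm// (le_trans _ t1)// /e invr_ge0 mulr_ge0// ltW.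
  by rewrite sumr_const card_ord -mulr_natl le_eqVlt; apply/orP; left; apply/eqP; field.
have Sa : S a <= 2 / 3 by have := key2 a; rewrite aG; lra.
have e0 : 0 < e by rewrite invr_gt0 mulr_gt0.
exists a; split => // [i|].
  have /andP[t1 _] := tI i; have := key a i; rewrite aG ler_distl => /andP[h _].
  apply: le_trans h; rewrite subr_ge0 (le_trans _ t1)//.
  by rewrite -[leRHS]mulr1 ler_wpM2l ?(ltW e0)//; lra.
rewrite (@le_trans _ _ (S a))//; last by lra.
by apply: ler_sum => i _; rewrite ler_norm.
Qed.

(** The coordinates given by an almost dual frame map the simplex onto a set
    containing a cube of side 1/(4k). *)
Lemma hausdorff_simplex_ge {R : realType} {n : nat} (k : nat)
    (y l : nat -> 'rV[R]_n) (M : R) (A : set 'rV[R]_n) : (0 < k)%N -> 0 < M ->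
  (forall i, (i <= k)%N -> A (y i)) ->
  (forall j, (j < k)%N -> enorm (l j) <= M) ->
  (forall i j, (i < k)%N -> (j < k)%N ->
     `|dotp (y i.+1 - y 0%N) (l j) - (i == j)%:R| <= (4 * k%:R)^-1) ->
  ((unit_ball_volume R k / 2 ^+ k * (8 * k%:R * M) ^- k)%:E <=
    hausdorff k (Defs.conv A))%E.
Proof.
move=> k0 M0 Ay lM yl; have kp : 0 < k%:R :> R by rewrite ltr0n.
set e := (4 * k%:R)^-1 in yl.
have -> : (8 * k%:R * M) ^- k = (e / (2 * M)) ^+ k.
  by rewrite -exprVn; congr (_ ^+ k); rewrite /e; field; rewrite !gt_eqF.
have e0 : 0 <= e by rewrite invr_ge0 mulr_ge0// ltW.
apply: (@hausdorff_ge_cube _ _ _ _ (y 0%N) l M e) => // t te.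
pose G := \matrix_(i < k, j < k) dotp (y i.+1 - y 0%N) (l j).
pose tv := \row_(j < k) t j.
have ee : e + e = (2 * k%:R)^-1 by rewrite /e; field; rewrite gt_eqF.
have [||a [aG a0 a1]] := @near_identity_solve _ _ G tv k0.
- by move=> i j; rewrite mxE; exact: yl.
- by move=> j; rewrite mxE -ee te.
pose b i := if i is i'.+1 then (if insub i' is Some o then a ord0 o else 0)
  else 1 - \sum_i a ord0 i.
have bE (i : 'I_k) : b i.+1 = a ord0 i.
  by rewrite /b insubT//= => ik; congr (a _ _); exact: val_inj.
have b1 : \sum_(i < k.+1) b i = 1.
  rewrite big_ord_recl; under eq_bigr => i _ do rewrite lift0 bE.
  exact: subrK.
exists (\sum_(i < k.+1) b i *: y i).
  apply: conv_sum => // -[_|i ik]; first by rewrite /b subr_ge0.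
  by rewrite (bE (Ordinal ik)).
move=> j jk.
have -> : \sum_(i < k.+1) b i *: y i - y 0%N =
    \sum_(i < k) a ord0 i *: (y i.+1 - y 0%N).
  rewrite -[X in _ - X]scale1r -b1 scaler_suml -sumrB big_ord_recl subrr add0r.
  by apply: eq_bigr => i _; rewrite lift0 bE scalerBr.
rewrite dotp_suml; have := congr1 (fun v : 'rV[R]_k => v ord0 (Ordinal jk)) aG.
by rewrite !mxE => <-; apply: eq_bigr => i _; rewrite mxE dotpZl.
Qed.

(** * Balls are Hausdorff measurable *)

Lemma ereal_supD_le {R : realType} (A B : set (\bar R)) (c : \bar R) :
  A !=set0 -> B !=set0 ->
  (forall a, A a -> (0 <= a)%E) -> (forall b, B b -> (0 <= b)%E) ->
  (forall a b, A a -> B b -> (a + b <= c)%E) ->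
  (ereal_sup A + ereal_sup B <= c)%E.
Proof.
move=> [a1 Aa1] [b1 Bb1] A0 B0 AB.
have c0 : (0 <= c)%E.
  by apply: le_trans (AB _ _ Aa1 Bb1); rewrite adde_ge0//; [exact: A0|exact: B0].
have [->|cfin] := eqVneq c +oo%E; first by rewrite leey.
have {}cfin : c \is a fin_num by rewrite ge0_fin_numE// ltey.
have sA b : B b -> (ereal_sup A + b <= c)%E.
  move=> Bb; have bfin : b \is a fin_num.
    rewrite ge0_fin_numE ?B0// (@le_lt_trans _ _ c) ?ltey_eq ?cfin//.
    by rewrite (le_trans _ (AB _ _ Aa1 Bb))// leeDr// A0.
  by rewrite -leeBrDr//; apply: ge_ereal_sup => a Aa; rewrite leeBrDr// AB.
have sfin : ereal_sup A \is a fin_num.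
  rewrite ge0_fin_numE.
    rewrite (@le_lt_trans _ _ c) ?ltey_eq ?cfin//.
    by rewrite (le_trans _ (sA _ Bb1))// leeDl// B0.
  by rewrite (le_trans (A0 _ Aa1))//; exact: ereal_sup_ubound.
rewrite addeC -leeBrDr//; apply: ge_ereal_sup => b Bb.
by rewrite leeBrDr// addeC sA.
Qed.

Section ball_measurable.
Context {R : realType} {n : nat}.
Implicit Types (P Q X : set 'rV[R]_n) (x : 'rV[R]_n).
Local Open Scope ereal_scope.

Lemma hausdorff_content_antitone k (d e : R) P : (d <= e)%R ->
  hausdorff_content k e P <= hausdorff_content k d P.
Proof.
move=> de; apply: ereal_inf_le_tmp => _ [F [Fd PF] <-].
by exists F => //; split => // i; rewrite (le_trans (Fd i)).
Qed.

(** A covering set smaller than the gap between P and Q meets only one of them. *)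
Lemma hausdorff_content_separated k (d e : R) P Q : (d < e)%R ->
  (forall p q, P p -> Q q -> (e <= enorm (p - q))%R) ->
  hausdorff_content k d P + hausdorff_content k d Q <=
    hausdorff_content k d (P `|` Q).
Proof.
move=> de PQ; apply: le_ereal_inf_tmp => _ [F [Fd PQF] <-].
pose G P i := if `[< F i `&` P !=set0 >] then F i else set0.
have Gc P' : P' `<=` \bigcup_i F i ->
    hausdorff_content k d P' <= \sum_(i <oo) hausdorff_gauge k (G P' i).
  move=> PF; apply: ereal_inf_lbound; exists (G P') => //; split.
    move=> i; rewrite /G; case: asboolP => //= _.
    by rewrite diam0 (le_trans (diam_ge0 (F i))).
  move=> p Pp; have [i _ Fip] := PF _ Pp.
  by exists i => //; rewrite /G; case: asboolP => //= -[]; exists p.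
apply: (le_trans (leeD (Gc P _) (Gc Q _))).
- by apply: subset_trans PQF => p; left.
- by apply: subset_trans PQF => p; right.
rewrite -nneseriesD; last 2 first.
- by move=> i _ _; exact: hausdorff_gauge_ge0.
- by move=> i _ _; exact: hausdorff_gauge_ge0.
apply: lee_nneseries => i _.
  by move=> _; rewrite adde_ge0 ?hausdorff_gauge_ge0.
rewrite /G; case: asboolP => [[p [Fp Pp]]|_]; case: asboolP => [[q [Fq Qq]]|_].
- have := enorm_le_diam Fp Fq => /le_trans/(_ (Fd i)); rewrite lee_fin => h.
  by have := lt_le_trans de (PQ _ _ Pp Qq); rewrite ltNge h.
- by rewrite hausdorff_gauge0 adde0.
- by rewrite hausdorff_gauge0 add0e.
- by rewrite !hausdorff_gauge0 adde0 hausdorff_gauge_ge0.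
Qed.

Lemma hausdorff_separated k (e : R) P Q : (0 < e)%R ->
  (forall p q, P p -> Q q -> (e <= enorm (p - q))%R) ->
  hausdorff k P + hausdorff k Q <= hausdorff k (P `|` Q).
Proof.
move=> e0 PQ; apply: ereal_supD_le.
- by exists (hausdorff_content k 1 P); exists 1%R => //=.
- by exists (hausdorff_content k 1 Q); exists 1%R => //=.
- by move=> _ [d _ <-]; exact: hausdorff_content_ge0.
- by move=> _ [d _ <-]; exact: hausdorff_content_ge0.
move=> _ _ [d /= d0 <-] [d' /= d'0 <-].
(* e / 2 makes g strictly smaller than the gap e. *)
pose g := Num.min d (Num.min d' (e / 2)%R).
have g0 : (0 < g)%R by rewrite !lt_min d0 d'0 divr_gt0.
have ge : (g < e)%R.
  by rewrite /g !gt_min; apply/orP; right; apply/orP; right; lra.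
apply: (@le_trans _ _ (hausdorff_content k g P + hausdorff_content k g Q)).
  apply: leeD; apply: hausdorff_content_antitone; first by rewrite ge_min lexx.
  by rewrite !ge_min lexx orbT.
apply: le_trans (hausdorff_content_separated k ge PQ) _.
by apply: ereal_sup_ubound; exists g.
Qed.

(** Caratheodory's argument.  The ball of radius r is exhausted by the balls of
    radius a j, which are separated from its complement.  The shells between
    them that are two steps apart are separated from each other, so their
    measures form a convergent series and the missing shells are negligible. *)
Lemma caratheodory_measurable_eball k x (r : R) :
  (hausdorff k : set 'rV[R]_n -> \bar R).-caratheodory (eball x r).
Proof.
apply: (@le_caratheodory_measurable R _ (hausdorff k)) => X.
pose H : set 'rV[R]_n -> \bar R := hausdorff k.
change (H (X `&` eball x r) + H (X `&` ~` eball x r) <= H X).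
have [->|HX] := eqVneq (H X) +oo; first by rewrite leey.
have {}HX : H X < +oo by rewrite ltey.
pose a j : R := (r - j.+1%:R^-1)%R.
have a_lt j : (a j < a j.+1)%R by rewrite ltrD2l ltrN2 ltf_pV2 ?posrE// ltr_nat.
have a_r j : (a j < r)%R by rewrite gtrDl oppr_lt0 invr_gt0.
pose f (c : R) := X `&` eball x c.
pose S j := X `&` [set y | (a j.+1 <= enorm (y - x) < a j.+2)%R].
have a_mono i j : (i <= j)%N -> (a i <= a j)%R.
  by move=> ij; rewrite lerD2l lerN2 lef_pV2 ?posrE// ler_nat.
have sep (b c : R) Y : (b < c)%R -> Y `<=` X ->
    (forall y, Y y -> (c <= enorm (y - x))%R) ->
    H (f b) + H Y <= H (f b `|` Y).
  move=> bc YX Yc; apply: (@hausdorff_separated _ (c - b)); first by rewrite subr_gt0.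
  move=> p q [_ /= pb] /Yc qc; have := enorm_triangle p q x.
  rewrite (enormB q p); move: pb; rewrite /eball/=; lra.
have telescope N : \sum_(0 <= i < N) H (S i) <= H (f (a N)) + H (f (a N.+1)).
  elim: N => [|N IH]; first by rewrite big_nil adde_ge0 ?hausdorff_ge0.
  rewrite big_nat_recr//= (le_trans (leeD2r _ IH))//.
  rewrite addeAC addeC leeD2l//.
  apply: le_trans (@sep (a N) (a N.+1) (S N) _ _ _) _ => //.
  - by move=> y [].
  - by move=> y [_ /= /andP[]].
  apply: le_hausdorff => y [[Xy /= ya]|[Xy /= /andP[_ ya]]]; split => //=.
  by rewrite /eball/= (lt_trans ya)// (lt_trans (a_lt _)).
have Sfin : \sum_(0 <= i <oo) H (S i) < +oo.
  apply: (@le_lt_trans _ _ (H X + H X)); last by rewrite lte_add_pinfty.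
  apply: lime_le; first by apply: is_cvg_nneseries => i _ _; exact: hausdorff_ge0.
  apply: nearW => N; apply: (le_trans (telescope N)).
  by apply: leeD; apply: le_hausdorff => y [].
have tail := nneseries_tail_cvg Sfin (fun i _ => hausdorff_ge0 k (S i)).
have bound j : H (X `&` eball x r) + H (X `&` ~` eball x r) <=
    H X + \sum_(j <= i <oo) H (S i).
  have cover : X `&` eball x r `<=`
      f (a j.+1) `|` \bigcup_(i in ~` `I_j) S i.
    move=> y [Xy yr]; have [ya|ya] := ltP (enorm (y - x)) (a j.+1); [by left|right].
    have [N yN] : exists N, (enorm (y - x) < a N)%R.
      by have [N hN] := ltr_add_invr yr; exists N; rewrite ltrBrDr.
    have [M yM Mmin] := ex_minnP (ex_intro (fun i => (enorm (y - x) < a i)%R) N yN).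
    have jM : (j.+1 < M)%N.
      rewrite ltnNge; apply/negP => /a_mono aM.
      by move: yM; rewrite ltNge (le_trans aM ya).
    (* By minimality y lies in the shell between a M.-1 and a M. *)
    case: M jM yM Mmin => [|[|M]]// jM yM Mmin; exists M.
      by apply/negP => /=; rewrite -leqNgt.
    split => //=; rewrite yM andbT leNgt; apply/negP => /Mmin.
    by rewrite ltnn.
  have h1 : H (X `&` eball x r) <= H (f (a j.+1)) + \sum_(j <= i <oo) H (S i).
    apply: (le_trans (le_hausdorff k cover)).
    apply: (le_trans (outer_measureU2 (hausdorff k) _ _)).
    by rewrite leeD2l// outer_measure_sigma_subadditive_tail.
  rewrite (le_trans (leeD2r _ h1))// addeAC leeD2r//.
  rewrite (le_trans (@sep _ r (X `&` ~` eball x r) (a_r j.+1) _ _))//.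
  - by move=> y [_ /negP]; rewrite -leNgt.
  - by apply: le_hausdorff => y [] [].
have lim_bound : (fun j => H X + \sum_(j <= i <oo) H (S i)) @ \oo --> H X + 0.
  apply: cvgeD => //; first by rewrite fin_num_adde_defl.
  exact: cvg_cst.
by rewrite -[leRHS]adde0; apply: (cvge_to_ge lim_bound); exact: nearW.
Qed.

End ball_measurable.

(** * From large beta to large energy *)

Lemma extend_vspace {K : fieldType} {vT : vectType K} (U : {vspace vT}) (m : nat) :
  (\dim U <= m)%N -> (m <= \dim {:vT})%N ->
  exists2 V : {vspace vT}, (U <= V)%VS & \dim V = m.
Proof.
move=> Um mT; have [j mE] : exists j, m = (\dim U + j)%N.
  by exists (m - \dim U)%N; rewrite subnKC.
elim: j => [|j IH] in U Um mE *; first by exists U; rewrite ?mE ?addn0.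
have /subvPn[v _ vU] : ~~ (fullv <= U)%VS.
  apply/negP => /dimvS; rewrite leqNgt => /negP; apply.
  by rewrite (leq_trans _ mT)// mE addnS ltnS leq_addr.
have UUv : (U <= U + <[v]>)%VS by exact: addvSl.
have dimUv : \dim (U + <[v]>)%VS = (\dim U).+1.
  apply/eqP; rewrite eqn_leq; apply/andP; split.
    rewrite (leq_trans (dimv_add_leqif U <[v]>%VS).1)// -addn1 leq_add2l dim_vline.
    by case: (v != 0).
  rewrite ltn_neqAle (dimv_leqif_sup UUv).1 (dimv_leqif_sup UUv).2 andbT.
  by apply: contra vU => /subvP; apply; apply: (subvP (addvSr U _)); exact: memv_line.
have [||V UV VE] := IH (U + <[v]>)%VS.
- by rewrite dimUv mE addnS ltnS leq_addr.
- by rewrite dimUv mE addnS.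
by exists V => //; exact: subv_trans UV.
Qed.

Section beta_gap.
Context {R : realType} {n : nat}.

Lemma dist_set_ge0 (z : 'rV[R]_n) A : A !=set0 -> 0 <= dist_set z A.
Proof.
move=> [y Ay]; apply: lb_le_inf; first by exists (enorm (z - y)), y.
by move=> _ [w _ <-]; exact: enorm_ge0.
Qed.

Lemma dist_set_le (z y : 'rV[R]_n) A : A y -> dist_set z A <= enorm (z - y).
Proof.
move=> Ay; apply: ge_inf; last by exists y.
by exists 0 => _ [w _ <-]; exact: enorm_ge0.
Qed.

(** The infimum in beta ranges over dimension exactly m, so U is first extended
    to dimension m; the extension only brings points closer. *)
Lemma beta_gap (m : nat) (Sigma : set 'rV[R]_n) x (r b : R) : (m <= n)%N ->
  0 < r -> Sigma x -> b < r * beta m Sigma x r ->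
  forall U : {vspace 'rV[R]_n}, (\dim U <= m)%N ->
    exists2 w, [set w | Sigma (x + w) /\ enorm w <= r] w &
      forall h, h \in U -> b <= enorm (w - h).
Proof.
move=> mn r0 Sx br U Um.
have [|H UH Hm] := extend_vspace Um; first by rewrite dimvf/= /dim/= mul1n.
pose D (H : {vspace 'rV[R]_n}) :=
  [set dist_set z (translate x H) | z in Sigma `&` ecball x r].
have tx (H' : {vspace 'rV[R]_n}) : translate x H' x.
  by exists 0; rewrite ?addr0//= mem0v.
have Dx H' : D H' (dist_set x (translate x H')).
  by exists x => //; split => //; rewrite /ecball/= subrr enorm0 ltW.
have Dub H' : has_ubound (D H').
  exists r => _ [z [_ zr] <-]; apply: le_trans zr; exact: dist_set_le.
have : b < sup (D H).
  apply: (lt_le_trans br); rewrite /beta mulrA divff ?gt_eqF// mul1r.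
  apply: ge_inf; last by exists H.
  exists 0 => _ [H' _ <-]; apply: le_trans (ub_le_sup (Dub H') (Dx H')).
  by apply: dist_set_ge0; exists x.
move=> /sup_gt[|_ [z [Sz zr] <-] bz]; first by exists (dist_set x (translate x H)).
exists (z - x); first by split => //; rewrite addrC subrK.
move=> h hU; rewrite (le_trans (ltW bz))// -addrA -opprD.
by apply: dist_set_le; exists h => //=; exact: (subvP UH).
Qed.

End beta_gap.

Lemma lee_powR_poweR {R : realType} (a p : R) (x : \bar R) : 0 < p -> 0 <= a ->
  (a%:E <= x)%E -> ((a `^ p)%:E <= x `^ p)%E.
Proof.
move=> p0 a0; case: x => [x||]//; last by rewrite poweRyr ?leey// gt_eqF.
rewrite poweR_EFin !lee_fin => ax.
by rewrite ge0_ler_powR ?nnegrE ?(ltW p0)// (le_trans a0).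
Qed.

Section energy_lower_bound.
Context {R : realType} {n : nat}.

(** The constant of hausdorff_simplex_ge, times the factor 4^-(k+1) that comes
    from simplices of diameter at most 4r. *)
Definition curvature_const (R : realType) (k : nat) : R :=
  unit_ball_volume R k / 2 ^+ k * (8 * k%:R) ^- k * 4 ^- k.+1.

Lemma curvature_const_gt0 k : (0 < k)%N -> 0 < curvature_const R k.
Proof.
move=> k0; rewrite /curvature_const !mulr_gt0 ?invr_gt0 ?exprn_gt0//.
  exact: unit_ball_volume_gt0.
by rewrite mulr_gt0// ltr0n.
Qed.

Lemma discrete_curvature_ge (m : nat) (t : m.+2.-tuple 'rV[R]_n)
    (l : nat -> 'rV[R]_n) x (r N : R) : 0 < r -> 0 < N ->
  (forall i : 'I_m.+2, enorm (tnth t i - x) <= 2 * r) ->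
  (forall j, (j < m.+1)%N -> enorm (l j) <= N / r) ->
  (forall i j, (i < m.+1)%N -> (j < m.+1)%N ->
     `|dotp (nth 0 t i.+1 - nth 0 t 0%N) (l j) - (i == j)%:R|
       <= (4 * m.+1%:R)^-1) ->
  ((curvature_const R m.+1 * N^-1 ^+ m.+1 / r)%:E <= discrete_curvature t)%E.
Proof.
move=> r0 N0 tx lN tl; set k := m.+1.
have kp : 0 < k%:R :> R by rewrite ltr0n.
have dE : (diam [set` t] <= (4 * r)%:E)%E.
  apply: diam_le; first by rewrite mulr_ge0// ltW.
  move=> y z /= /tnthP[i ->] /tnthP[j ->].
  rewrite (le_trans (enorm_triangle x _ _))// (enormB x).
  have := tx i; have := tx j; lra.
have dfin : diam [set` t] \is a fin_num.
  by rewrite ge0_fin_numE ?diam_ge0// (le_lt_trans dE)// ltry.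
set d := fine (diam [set` t]).
have d0 : 0 <= d by rewrite fine_ge0// diam_ge0.
have dr : d <= 4 * r by rewrite -lee_fin /d fineK.
have Nr : 0 < N / r by rewrite divr_gt0.
have tA i : (i <= k)%N -> [set` t] (nth 0 t i).
  by move=> ik /=; rewrite mem_nth// size_tuple.
have := @hausdorff_simplex_ge _ _ k (fun i => nth 0 t i) l (N / r) [set` t] isT Nr tA lN tl.
set h := _ * _ ^- k => hH.
have h0 : 0 < h.
  rewrite /h mulr_gt0 ?divr_gt0 ?unit_ball_volume_gt0 ?exprn_gt0// invr_gt0 exprn_gt0//.
  by rewrite !mulr_gt0 ?invr_gt0.
have -> : curvature_const R k * N^-1 ^+ k / r = h * (4 * r) ^- k.+1.
  rewrite /curvature_const /h !exprMn exprVn [r ^+ k.+1]exprS [r^-1 ^+ k]exprVn.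
  field.
  by rewrite !expf_neq0 ?gt_eqF.
(* For d = 0 the quotient is +oo because the numerator is positive. *)
rewrite /discrete_curvature -/k -(fineK dfin) -/d -EFin_expe inver.
case: ifPn => [_|dN0].
  by rewrite gt0_muley ?leey// (lt_le_trans _ hH)// lte_fin.
have dp : 0 < d ^+ k.+1 by rewrite lt_def dN0 exprn_ge0.
rewrite EFinM; apply: lee_pmul => //; rewrite ?lee_fin ?(ltW h0)//.
  by rewrite invr_ge0 exprn_ge0// mulr_ge0// ltW.
have r40 : 0 < 4 * r by rewrite mulr_gt0.
by rewrite lef_pV2 ?posrE ?(exprn_gt0 _ r40)// lerXn2r// nnegrE ltW.
Qed.

(** The vertices x, x + v 0, ..., x + v m are moved independently within Sigma
    by at most s = r/(8kN).  Edges then change by at most 2s and coordinates by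
    at most 2s N/r = 1/(4k), so the curvature bound holds on a whole product of
    balls, whose measure is bounded below by regularity. *)
Lemma energy_ge (m : nat) (Sigma : set 'rV[R]_n) (p A R0 : R)
    (v l : nat -> 'rV[R]_n) x (r N : R) :
  (hausdorff m).-cara.-measurable Sigma -> 0 < p -> 0 < A ->
  (forall x r, Sigma x -> 0 < r < R0 ->
    ((A * r ^+ m)%:E <= hausdorff m (Sigma `&` eball x r))%E) ->
  Sigma x -> 0 < r < R0 -> 1 <= N ->
  (forall i, (i < m.+1)%N -> Sigma (x + v i) /\ enorm (v i) <= r) ->
  dual_system m.+1 v l ->
  (forall i, (i < m.+1)%N -> enorm (l i) <= N / r) ->
  (((curvature_const R m.+1 * N^-1 ^+ m.+1 / r) `^ p *
    (A * (r * N^-1 / (8 * m.+1%:R)) ^+ m) ^+ m.+2)%:E <= energy m p Sigma)%E.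
Proof.
move=> mS p0 A0 regS Sx /andP[r0 rR0] N1 vS dvl lN.
have N0 : 0 < N by exact: lt_le_trans N1.
set k := m.+1; have kp : 0 < k%:R :> R by rewrite ltr0n.
have k1 : 1 <= k%:R :> R by rewrite ler1n.
set s := r * N^-1 / (8 * k%:R).
have s0 : 0 < s by rewrite divr_gt0 ?divr_gt0 ?mulr_gt0.
have sr : s <= r.
  rewrite /s -[leRHS]mulr1 -mulrA ler_wpM2l ?(ltW r0)// -invfM invf_le1.
    by rewrite -[leLHS]mulr1 ler_pM//; lra.
  by rewrite !mulr_gt0.
pose y i := if i is j.+1 then x + v j else x.
have yS i : (i < m.+2)%N -> Sigma (y i) by case: i => //= i im; have [] := vS i im.
have yr i : (i < m.+2)%N -> enorm (y i - x) <= r.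
  case: i => [_|i im] /=; first by rewrite subrr enorm0 ltW.
  by rewrite addrAC subrr add0r; have [] := vS i im.
pose B i := Sigma `&` eball (y i) s.
apply: (@iterated_integral_ge _ (caratheodory_type (hausdorff m : set 'rV[R]_n -> \bar R))
  R (hausdorff_measure m) Sigma m.+2 _ B).
- by rewrite mulr_ge0 ?exprn_ge0 ?(ltW s0) ?(ltW A0).
- exact: powR_ge0.
- by move=> t; exact: poweR_ge0.
- move=> i im; split.
  + by apply: measurableI => //; exact: caratheodory_measurable_eball.
  + by move=> ? [].
  + by apply: regS; [exact: yS|rewrite s0 (le_lt_trans sr)].
move=> t tB; apply: lee_powR_poweR => //.
  rewrite divr_ge0 ?(ltW r0)// mulr_ge0 ?(ltW (curvature_const_gt0 _))//.
  by rewrite exprn_ge0// invr_ge0 ltW.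
have ty i : (i < m.+2)%N -> enorm (nth 0 t i - y i) <= s.
  move=> im; have [_ /ltW] := tB (Ordinal im).
  by rewrite (tnth_nth 0).
apply: (@discrete_curvature_ge _ _ l x) => //.
  move=> i; rewrite (le_trans (enorm_triangle (y i) _ _))//.
  by rewrite (tnth_nth 0); have := ty i (ltn_ord i); have := yr i (ltn_ord i); lra.
move=> i j ik jk; rewrite -(dvl i j)// -dotpBl (le_trans (norm_dotp_le _ _))//.
have -> : nth 0 t i.+1 - nth 0 t 0%N - v i =
    (nth 0 t i.+1 - y i.+1) - (nth 0 t 0%N - y 0%N).
  by apply/rowP => q; rewrite /= !mxE; ring.
have -> : (4 * k%:R)^-1 = (s + s) * (N / r).
  by rewrite /s; field; rewrite !gt_eqF.
rewrite ler_pM ?enorm_ge0 ?lN// (le_trans (enormD _ _))// enormN lerD// ty//.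
Qed.

End energy_lower_bound.

(** * Exponents *)

(** In the energy bound g occurs with total exponent P = k p + a and r with
    exponent a - p, where a = m (m + 2).  Solving for g gives a power of r that
    is positive exactly when p > a. *)
Lemma solve_exponents {R : realType} (kappa A c p E g r a P : R) (k m : nat) :
  a = (m * m.+2)%:R -> P = k%:R * p + a ->
  (0 < k)%N -> 0 < kappa -> 0 < A -> 0 < c -> 0 < p -> 0 < g -> 0 < r ->
  (kappa * g ^+ k / r) `^ p * (A * (r * g / c) ^+ m) ^+ m.+2 <= E ->
  g <= (E / (kappa `^ p * (A / c ^+ m) ^+ m.+2)) `^ P^-1 * r `^ ((p - a) / P).
Proof.
move=> aE PE k0 ka0 A0 c0 p0 g0 r0; set d := _ `^ p * (A / _) ^+ _.
have kp : 0 < k%:R :> R by rewrite ltr0n.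
have a0 : 0 <= a by rewrite aE.
have P0 : 0 < P by rewrite PE ltr_wpDr// mulr_gt0.
have d0 : 0 < d by rewrite mulr_gt0 ?powR_gt0 ?exprn_gt0 ?divr_gt0 ?exprn_gt0.
have -> : (kappa * g ^+ k / r) `^ p * (A * (r * g / c) ^+ m) ^+ m.+2 =
    d * g `^ P / r `^ (p - a).
  rewrite !powRM ?mulr_ge0 ?invr_ge0 ?exprn_ge0 ?(ltW g0) ?(ltW ka0) ?(ltW r0)//.
  rewrite -powR_inv1 ?(ltW r0)// -powRrM mulN1r powRN.
  rewrite -(powR_mulrn k (ltW g0)) -powRrM.
  rewrite PE powRB ?(gt_eqF r0) ?implybT// powRD ?(gt_eqF g0) ?implybT//.
  rewrite aE !powR_mulrn ?(ltW g0) ?(ltW r0)// /d !exprM.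
  rewrite !exprMn exprVn.
  have rN : r `^ p != 0 by rewrite gt_eqF// powR_gt0.
  rewrite [X in _ = X]mulrC invf_div.
  by field.
have rp : 0 < r `^ (p - a) by rewrite powR_gt0.
rewrite ler_pdivrMr// => h.
have {}h : g `^ P <= E / d * r `^ (p - a) by rewrite mulrAC ler_pdivlMr// mulrC.
have E0 : 0 <= E / d.
  by rewrite -(pmulr_lge0 _ rp); apply: le_trans h; exact: powR_ge0.
rewrite powRrM -powRM ?(ltW rp)//.
have -> : g = (g `^ P) `^ P^-1 by rewrite -powRrM divff ?gt_eqF// powRr1// ltW.
by rewrite ge0_ler_powR ?nnegrE ?powR_ge0 ?invr_ge0 ?(ltW P0)// mulr_ge0// ltW.
Qed.

Theorem proposition1 (R : realType) (m n : nat) (m_gt0 : (0 < m)%N)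
    (m_lt_n : (m < n)%N) (Sigma : set 'rV[R]_n)
    (Sigma_measurable : (hausdorff m).-cara.-measurable Sigma)
    (Sigma_regular : ahlfors_regular m Sigma)
    (p : R) (p_gt : (m * (m + 2))%:R < p)
    (energy_finite : (energy m p Sigma < +oo)%E) :
  exists C tau : R, [/\ 0 < C, 0 < tau < 1 &
    exists2 r0 : R, 0 < r0 &
      forall (x : 'rV[R]_n) (r : R), Sigma x -> 0 < r < r0 ->
        beta m Sigma x r <= C * r `^ tau].
Proof.
have [A [R0 [A0 R00 regS]]] := Sigma_regular.
have [D [q [D1 q0 ND]]] := @dual_bound_poly R m.+1.
have D0 : 0 < D by exact: lt_le_trans D1.
have qp : 0 < q%:R :> R by rewrite ltr0n.
have q1 : 1 <= q%:R :> R by rewrite ler1n.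
rewrite addn2 in p_gt; set a : R := (m * m.+2)%:R in p_gt.
have ap : 0 < a by rewrite ltr0n muln_gt0 m_gt0.
have p0 : 0 < p by exact: lt_trans p_gt.
pose P := m.+1%:R * p + a.
have P0 : 0 < P by rewrite addr_gt0// mulr_gt0.
have pP : p <= P.
  by rewrite /P -natr1 mulrDl mul1r; have := mulr_ge0 (ler0n R m) (ltW p0); lra.
pose d := curvature_const R m.+1 `^ p * (A / (8 * m.+1%:R) ^+ m) ^+ m.+2.
pose F := (fine (energy m p Sigma) / d) `^ P^-1.
have F0 : 0 <= F by exact: powR_ge0.
pose C := (D * 2 ^+ q * F) `^ q%:R^-1.
have C0 : 0 <= C by exact: powR_ge0.
pose sigma := (p - a) / P.
have sigma0 : 0 < sigma by rewrite divr_gt0// subr_gt0.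
have sigma1 : sigma < 1 by rewrite ltr_pdivrMr// mul1r; lra.
exists (C + 1), (sigma / q%:R); split; first by rewrite ltr_wpDl.
  rewrite divr_gt0//= ltr_pdivrMr// mul1r (lt_le_trans sigma1)//.
exists R0 => // x r Sx rR0; have /andP[r0 _] := rR0.
suff betaC : beta m Sigma x r <= C * r `^ (sigma / q%:R).
  by rewrite (le_trans betaC)// ler_wpM2r ?powR_ge0// lerDl.
have [beta0|beta0] := leP (beta m Sigma x r) 0.
  by rewrite (le_trans beta0)// mulr_ge0 ?powR_ge0.
set be := beta m Sigma x r in beta0 *.
(* Half of r * beta, because the supremum in beta need not be attained. *)
pose b := r * be / 2.
have b0 : 0 < b by rewrite divr_gt0// mulr_gt0.
have gap := @beta_gap _ _ m Sigma x r b (ltnW m_lt_n) r0 Sx.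
have {}gap : forall U : {vspace 'rV[R]_n}, (\dim U <= m)%N ->
    exists2 w, [set w | Sigma (x + w) /\ enorm w <= r] w &
      forall h, h \in U -> b <= enorm (w - h).
  by apply: gap; rewrite -/be /b; have := mulr_gt0 r0 beta0; lra.
have br : b <= r.
  have [|w [_ wr] /(_ 0 (mem0v _))] := gap 0%VS; first by rewrite dimv0.
  by rewrite subr0 => /le_trans; exact.
have [v [l [vW dvl lN]]] :=
  exists_dual_system b0 br (fun w => @proj2 _ _) gap (leqnn m.+1).
have rbE : r / b = 2 / be by rewrite /b; field; rewrite !gt_eqF.
pose N := D * (2 / be) ^+ q.
have rb1 : 1 <= 2 / be by rewrite -rbE ler_pdivlMr// mul1r.
have N1 : 1 <= N by rewrite -[leLHS]mul1r ler_pM// exprn_ege1.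
have N0 : 0 < N by exact: lt_le_trans N1.
have lN' i : (i < m.+1)%N -> enorm (l i) <= N / r.
  move=> /lN/le_trans; apply; rewrite ler_pM2r ?invr_gt0// rbE; exact: ND.
have := energy_ge Sigma_measurable p0 A0 regS Sx rR0 N1 vW dvl lN'.
have Efin : energy m p Sigma \is a fin_num.
  rewrite ge0_fin_numE//; apply: iterated_integral_ge0 => t; exact: poweR_ge0.
rewrite -(fineK Efin) lee_fin.
move=> /(@solve_exponents _ _ _ _ _ _ _ _ a P _ _ erefl erefl) h.
have {}h : N^-1 <= F * r `^ sigma.
  by apply: h => //; rewrite ?curvature_const_gt0 ?invr_gt0.
have NE : N^-1 = be ^+ q / (D * 2 ^+ q).
  by rewrite /N expr_div_n; field; rewrite !expf_neq0 ?gt_eqF.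
have {}h : be ^+ q <= D * 2 ^+ q * F * r `^ sigma.
  by rewrite -mulrA mulrC -ler_pdivrMr ?mulr_gt0 ?exprn_gt0// -NE.
have DF0 : 0 <= D * 2 ^+ q * F by rewrite !mulr_ge0 ?exprn_ge0 ?(ltW D0).
have -> : C * r `^ (sigma / q%:R) = (D * 2 ^+ q * F * r `^ sigma) `^ q%:R^-1.
  by rewrite powRM ?powR_ge0// -powRrM.
have -> : be = (be ^+ q) `^ q%:R^-1.
  by rewrite -powR_mulrn ?(ltW beta0)// -powRrM divff ?gt_eqF// powRr1// ltW.
rewrite ge0_ler_powR ?nnegrE ?exprn_ge0 ?invr_ge0 ?(ltW qp) ?(ltW beta0)//.
by rewrite mulr_ge0// powR_ge0.
Qed.
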